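(* Let $\mathbf X$ and $\mathbf Y$ be independent stationary ergodic processes on $\mathcal A=\{0,1,\ldots,N-1\}$ which are non-null and have summable continuity rate, and let $\mathbf Z$ be defined by $Z_t=X_t$ if $\xi_t=1$ and $Z_t=Y_t$ if $\xi_t=0$, where $(\xi_t)_{t\in\mathbb Z}$ are i.i.d. $\{0,1\}$-valued, independent of $\mathbf X$ and $\mathbf Y$, with $\mathbb P(\xi_t=1)=1-\varepsilon$. Then, for all $\varepsilon\in(0,1)$, $$\sup_{k\ge1}\ \sup_{a\in\mathcal A}\ \sup_{\omega_{-k}^{-1}\in\mathcal A_{-k}^{-1}}\left|p_Z\left(a|\omega_{-k}^{-1}\right)-p_X\left(a|\omega_{-k}^{-1}\right)\right|\le\varepsilon\left[2+\frac{4(N-1)\beta_X}{\min\left(1,\alpha\beta^*_{\min}\right)}\right],$$ where $\beta_X^*=\prod_{k=0}^{+\infty}(1-\beta_{k,X})>0$ and $\alpha\beta^*_{\min}=\min\{\alpha_X\beta_X^*,\alpha_Y\}$.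
   Context: $\mathcal A_{-k}^{-1}$ is the set of strings $\omega_{-k}^{-1}=\omega_{-k}\ldots\omega_{-1}$ over $\mathcal A$ and $\mathcal A_{-\infty}^{-1}$ the set of semi-infinite pasts $\ldots\omega_{-2}\omega_{-1}$. For a process $\mathbf W\in\{\mathbf X,\mathbf Y\}$, $p_W(a|\omega)=\mathbb P(W_0=a|W_{-1}=\omega_{-1},W_{-2}=\omega_{-2},\ldots)$ for $\omega\in\mathcal A_{-\infty}^{-1}$; for finite strings and any stationary process $\mathbf W$, $p_W(a|\omega_{-k}^{-1})=\mathbb P(W_0=a|W_{-k}^{-1}=\omega_{-k}^{-1})$. Non-null: $\alpha_W:=\inf\{p_W(a|\omega):a\in\mathcal A,\omega\in\mathcal A_{-\infty}^{-1}\}>0$. Summable continuity rate: $\beta_W:=\sum_{k\in\mathbb N}\beta_{k,W}<\infty$ with $\mathbb N=\{0,1,2,\ldots\}$, where $\beta_{k,W}:=\sup\{|1-p_W(a|\omega)/p_W(a|v)|:a\in\mathcal A,\ \omega,v\in\mathcal A_{-\infty}^{-1},\ \omega_{-k}^{-1}=v_{-k}^{-1}\}$. The positivity $\beta_X^*>0$ is a standing condition.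
   Formalization: The positivity of the infinite product β_X^* is taken to include β_{k,X}<1 for every k; with only the limit of the product positive (an even number of negative factors allowed) the claimed bound fails, e.g. for a noisy order-2 xor chain X. *)

(* Defs.v *)
From HB Require Import structures.
From mathcomp Require Import all_boot all_order all_algebra.
From mathcomp Require Import all_classical all_reals all_analysis.
Set Implicit Arguments.
Unset Strict Implicit.
Unset Printing Implicit Defensive.
Import Order.TTheory GRing.Theory Num.Theory.
Import numFieldNormedType.Exports.
Local Open Scope classical_set_scope.
Local Open Scope ring_scope.

(* The coordinate singletons generate the product sigma-algebra because every
   alphabet used here is countable (and carries its discrete sigma-algebra). *)
Definition cylinders (I A : Type) : set (set (I -> A)) :=
  [set C | exists (t : I) (a : A), C = [set x | x t = a]].

Definition prod_salgebra (I A : Type) : set (set (I -> A)) :=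
  <<s @cylinders I A >>.

Section Processes.
Context (d : measure_display) (T : measurableType d) (R : realType).
Variable P : probability T R.

Definition is_process (A : Type) (W : int -> T -> A) : Prop :=
  forall (t : int) (a : A), measurable (W t @^-1` [set a]).

Definition trajectory (A : Type) (W : int -> T -> A) (w : T) : int -> A :=
  fun t => W t w.

Definition time_shift (A : Type) (x : int -> A) : int -> A := fun t => x (t + 1).

Definition stationary (A : Type) (W : int -> T -> A) : Prop :=
  forall B, @prod_salgebra int A B ->
    P (trajectory W @^-1` (@time_shift A @^-1` B)) = P (trajectory W @^-1` B).

Definition ergodic (A : Type) (W : int -> T -> A) : Prop :=
  forall B, @prod_salgebra int A B -> @time_shift A @^-1` B = B ->
    P (trajectory W @^-1` B) = 0%E \/ P (trajectory W @^-1` B) = 1%E.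

Definition independent_processes (A A' : Type)
    (W : int -> T -> A) (W' : int -> T -> A') : Prop :=
  forall B B', @prod_salgebra int A B -> @prod_salgebra int A' B' ->
    P (trajectory W @^-1` B `&` trajectory W' @^-1` B') =
    (P (trajectory W @^-1` B) * P (trajectory W' @^-1` B'))%E.

Definition pair_process (A A' : Type)
    (W : int -> T -> A) (W' : int -> T -> A') : int -> T -> A * A' :=
  fun t w => (W t w, W' t w).

Definition mutually_independent (A : Type) (W : int -> T -> A) : Prop :=
  forall (s : seq int) (B : int -> set A), uniq s ->
    P (\bigcap_(t in [set` s]) (W t @^-1` B t)) =
    (\prod_(t <- s) P (W t @^-1` B t))%E.

Definition bernoulli_iid (xi : int -> T -> bool) (q : R) : Prop :=
  mutually_independent xi /\
  forall t : int, P (xi t @^-1` [set true]) = q%:E.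

Definition mixture (A : Type) (xi : int -> T -> bool) (X Y : int -> T -> A) :
    int -> T -> A :=
  fun t w => if xi t w then X t w else Y t w.

(* Strings and pasts are read backwards in time: the entry of index i is the
   symbol at time -(i+1). *)
Definition past (A : Type) (W : int -> T -> A) (w : T) : nat -> A :=
  fun i => W (- (i.+1)%:Z) w.

Definition past_event (A : Type) (W : int -> T -> A) (k : nat)
    (s : k.-tuple A) : set T :=
  [set w | forall i : 'I_k, W (- (i.+1)%:Z) w = tnth s i].

Definition p_str (A : Type) (W : int -> T -> A) (a : A) (k : nat)
    (s : k.-tuple A) : R :=
  fine (P (W 0 @^-1` [set a] `&` past_event W s)) / fine (P (past_event W s)).

(* p is a regular version of P(W_0 = a | W_{-1}, W_{-2}, ...).  Under
   nonnull and summable_continuity below, such a p is unique: stationarity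
   and non-nullness give every cylinder of pasts positive probability, and p
   is continuous. *)
Definition is_past_cond_prob (A : finType) (W : int -> T -> A)
    (p : A -> (nat -> A) -> R) : Prop :=
  [/\ forall a x, 0 <= p a x,
      forall x, \sum_(a : A) p a x = 1,
      forall a (V : set R), measurable V -> @prod_salgebra nat A (p a @^-1` V)
    & forall a (B : set (nat -> A)), @prod_salgebra nat A B ->
        P (W 0 @^-1` [set a] `&` past W @^-1` B) =
        (\int[P]_(w in past W @^-1` B) (p a (past W w))%:E)%E ].

End Processes.

Section Continuity.
Context (R : realType) (A : Type).
Implicit Type p : A -> (nat -> A) -> R.

Definition alpha p : R := inf [set r | exists a x, r = p a x].

Definition nonnull p : Prop := 0 < alpha p.

(* For non-null p with values in [0, 1], the set below is bounded and no
   denominator vanishes. *)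
Definition beta p (k : nat) : R :=
  sup [set r | exists a (x y : nat -> A),
         (forall i, (i < k)%N -> x i = y i) /\ r = `|1 - p a x / p a y| ].

Definition summable_continuity p : Prop := cvgn (series (beta p)).

Definition beta_total p : R := limn (series (beta p)).

Definition beta_star p : R := limn (fun n => \prod_(k < n) (1 - beta p k)).

End Continuity.

(* Main.v *)
Require Import Defs.
From mathcomp Require Import all_boot all_order all_algebra.
From mathcomp Require Import all_classical all_reals all_analysis.
From mathcomp Require Import measurable_realfun ring lra.
Import Order.TTheory GRing.Theory Num.Theory.
Import numFieldNormedType.Exports.
Local Open Scope classical_set_scope.
Local Open Scope ring_scope.

(** Strings are written backwards in time, so that [a :: s] is the present
symbol [a] preceded by the past [s]. Let [q] be the law of the strings of X, let
[k(a|s) = q (a :: s) / q s], and fix the past [s] that Z is observed to have.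

Since [xi 0] is independent of all the rest, the law of [Z 0] given the past of Z
is the mixture, with weights [1 - eps] and [eps], of the laws of [X 0] and [Y 0]
given the past of Z. Replacing the second of them by the first costs at most [eps].
It remains to compare the law of [X 0] given that Z has past [s] with [k(.|s)].

Once the past [x] of X is known, the past of Z brings no further information on
[X 0]; the law of [X 0] given the past of Z is therefore the average of [k(.|x)]
over the law of [x] given the past of Z ([kernel_deviation]). If [j] is the most recent index at which [x] and [s]
disagree, then [k(.|x)] and [k(.|s)] differ by at most [beta j], because a
continuity rate for the kernel with infinite pasts passes to averages over
cylinders ([regular_string_law_of_process], [kernel_continuity]). It is thus
enough to show that the conditional probability that X and [s] disagree at [j] is
at most [eps / m], where [m = min(1, alpha beta_star, ...)]; the sum over [j]
then gives [eps * beta / m].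

For this last bound ([mass_mismatch]) let [E] be the event that Z agrees with [s]
except possibly at [j], and let [x_j], [y_j] be the symbols of X and Y at [j].
Conditioning on [xi] at the time [j] yields
  P(x_j <> s_j, Z past = s) = eps P(x_j <> s_j, y_j = s_j, E),
  P(Z past = s) = (1 - eps) P(x_j = s_j, E) + eps P(y_j = s_j, E).
The second line is a convex combination of two numbers that are both at least
[m] times the probability [p] on the right of the first line: the second one since
[m <= 1], and the first one since [P(x_j = s_j, E) >= alpha beta_star P(E)].
This lower bound is a one-site estimate ([single_site]): replacing one
symbol of a string of X by [c] multiplies the probability of each later symbol by
at least [1 - beta i], where [i] counts the symbols in between, and the symbol
[c] itself has conditional probability at least [alpha].

The result is the bound [eps (1 + (N - 1) beta / m)], where the factor [N - 1]
takes care of the alphabet with one letter, on which X and [s] cannot disagree. *)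

Set Implicit Arguments.
Unset Strict Implicit.
Unset Printing Implicit Defensive.

(** * Changing one entry of a tuple *)

Section TupleUpdate.
Context (A : finType) (n : nat).
Implicit Types (x : n.-tuple A) (t i : 'I_n) (a b : A).

Definition upd x t a : n.-tuple A :=
  [tuple if i == t then a else tnth x i | i < n].

Lemma tnth_upd x t a i : tnth (upd x t a) i = if i == t then a else tnth x i.
Proof. by rewrite tnth_mktuple. Qed.

Lemma upd_updK x t a b : tnth x t = b -> upd (upd x t a) t b = x.
Proof.
move=> <-; apply: eq_from_tnth => i; rewrite !tnth_upd.
by case: eqP => [->|].
Qed.

Lemma val_upd x t a : upd x t a = take t x ++ a :: drop t.+1 x :> seq A.
Proof.
have st : size (take t x) = t by rewrite size_takel // size_tuple ltnW.
apply: (@eq_from_nth _ a).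
  by rewrite size_tuple size_cat /= st size_drop size_tuple addnS -addSn subnKC.
move=> i; rewrite size_tuple => ltin.
rewrite -(tnth_nth a (upd x t a) (Ordinal ltin)) tnth_upd nth_cat st.
rewrite -val_eqE /= (tnth_nth a) /=.
case: (ltngtP i t) => [lt|lt|->].
- by rewrite nth_take.
- by rewrite -(subnSK lt) /= nth_drop subnKC.
- by rewrite subnn.
Qed.

(** This splits a sum over all tuples into the fibres along the coordinate [t]. The
letter [b] serves to name one tuple in each fibre, so that two sums can be
compared fibre by fibre. *)
Lemma sum_upd (R : nmodType) t b (G : n.-tuple A -> R) :
  \sum_x G x = \sum_(x | tnth x t == b) \sum_a G (upd x t a).
Proof.
rewrite (partition_big (fun x => upd x t b) (fun x => tnth x t == b)) /=; last first.
  by move=> x _; rewrite tnth_upd eqxx.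
apply: eq_bigr => z /eqP zt.
rewrite (reindex_onto (fun a => upd z t a) (fun x => tnth x t)) /=; last first.
  by move=> x /eqP <-; rewrite upd_updK.
by apply: eq_bigl => a; rewrite upd_updK // eqxx tnth_upd !eqxx.
Qed.

End TupleUpdate.

(** * Independent coin tosses *)

Section ProductWeight.
Context (R : realFieldType) (eps : R) (n : nat).

Definition coin (b : bool) : R := if b then 1 - eps else eps.

Definition coins (e : n.-tuple bool) : R := \prod_i coin (tnth e i).

Lemma coins_upd e t b :
  coins (upd e t b) = coin b * \prod_(i | i != t) coin (tnth e i).
Proof.
rewrite /coins (bigD1 t) //= tnth_upd eqxx; congr (_ * _).
by apply: eq_bigr => i /negPf it; rewrite tnth_upd it.
Qed.

(** Independence of one toss from the others, as total probability. *)
Lemma sum_coins_resample t (g : n.-tuple bool -> R) :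
  \sum_e coins e * g e = (1 - eps) * (\sum_e coins e * g (upd e t true))
                         + eps * (\sum_e coins e * g (upd e t false)).
Proof.
rewrite 3!(sum_upd t true) !mulr_sumr -big_split /=.
apply: eq_bigr => e _; rewrite !big_bool !coins_upd /=.
have upd2 b b' : upd (upd e t b) t b' = upd e t b'.
  by apply: eq_from_tnth => i; rewrite !tnth_upd; case: eqP.
by rewrite !upd2; ring.
Qed.

End ProductWeight.

(** * Laws of strings with a continuous kernel *)

Section StringLaws.
Context (R : realType) (A : finType).
Implicit Types (q : seq A -> R) (s : seq A) (a : A).

(** The ratio [q (a :: s) / q s] is the kernel with a finite past; its bounds are
written without quotients. *)
Definition regular_string_law q (al : R) (b : nat -> R) : Prop :=
  [/\ forall s, 0 < q s,
      forall s, \sum_a q (a :: s) = q s,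
      forall a s, al * q s <= q (a :: s),
      forall a j s s', (j <= size s)%N -> (j <= size s')%N ->
        take j s = take j s' ->
        (1 - b j) * (q (a :: s') * q s) <= q (a :: s) * q s'
          <= (1 + b j) * (q (a :: s') * q s)
    & forall j, 0 <= b j <= 1].

Context (q : seq A -> R) (al : R) (b : nat -> R).
Context (q_reg : regular_string_law q al b).

Lemma prod_oneB_ge0 n : 0 <= \prod_(i < n) (1 - b i).
Proof.
case: q_reg => _ _ _ _ hb; apply: prodr_ge0 => i _.
by rewrite subr_ge0; case/andP: (hb i).
Qed.

(** Induction on the symbols [s1] that come after the changed one. Adding a symbol
in front multiplies the two sides by conditional probabilities of that symbol given
pasts that agree on [size s1] entries, whence the factor [1 - b (size s1)]. The
factors [q (a :: s2)] and [q (a' :: s2)] make up for the different conditional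
probabilities of the changed symbol itself. *)
Lemma string_swap s1 s2 a a' :
  \prod_(i < size s1) (1 - b i) * (q (s1 ++ a' :: s2) * q (a :: s2))
  <= q (s1 ++ a :: s2) * q (a' :: s2).
Proof.
have [qp _ _ qc hb] := q_reg.
elim: s1 => [|c s1 IH]; first by rewrite big_ord0 mul1r mulrC.
rewrite /= big_ord_recr /=.
have /andP[low _] := qc c (size s1) (s1 ++ a :: s2) (s1 ++ a' :: s2)
  ltac:(by rewrite size_cat leq_addr) ltac:(by rewrite size_cat leq_addr)
  ltac:(by rewrite !take_size_cat).
have /andP[_ hb1] := hb (size s1).
set Q := q (s1 ++ a :: s2) in IH low *; set Q' := q (s1 ++ a' :: s2) in IH low *.
set q1 := q (c :: s1 ++ a :: s2) in low *; set q1' := q (c :: s1 ++ a' :: s2) in low *.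
set PI := \prod_(i < _) _ in IH *; set be := b (size s1) in low hb1 *.
have Q'gt0 : 0 < Q' by exact: qp.
rewrite -(ler_pM2r Q'gt0).
apply: (@le_trans _ _ ((1 - be) * q1' * (Q * q (a' :: s2)))).
  have -> : PI * (1 - be) * (q1' * q (a :: s2)) * Q' =
            (1 - be) * q1' * (PI * (Q' * q (a :: s2))) by ring.
  apply: ler_wpM2l IH; apply: mulr_ge0; first by rewrite subr_ge0.
  exact/ltW/qp.
have -> : (1 - be) * q1' * (Q * q (a' :: s2)) =
          ((1 - be) * (q1' * Q)) * q (a' :: s2) by ring.
have -> : q1 * q (a' :: s2) * Q' = (q1 * Q') * q (a' :: s2) by ring.
by apply: ler_wpM2r low; exact/ltW/qp.
Qed.

(** The lower bound on the conditional probability of one symbol given all the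
others, the later ones included. Averaging [string_swap] over [a'] turns its factor
[q (a' :: s2)] into [q s2], which cancels. *)
Lemma single_site n (x : n.-tuple A) (t : 'I_n) a :
  al * \prod_(i < t) (1 - b i) * \sum_a' q (upd x t a') <= q (upd x t a).
Proof.
have [qp qs qal _ _] := q_reg.
set s1 := take t x; set s2 := drop t.+1 x.
have st : size s1 = t by rewrite size_takel // size_tuple ltnW.
have -> : \sum_a' q (upd x t a') = \sum_a' q (s1 ++ a' :: s2).
  by apply: eq_bigr => a' _; rewrite val_upd.
rewrite val_upd -/s1 -/s2 -(ler_pM2r (qp s2)) -[X in _ <= _ * X]qs mulr_sumr.
rewrite mulr_sumr mulr_suml; apply: ler_sum => a' _.
apply: le_trans (string_swap s1 s2 a a').
rewrite st.
have -> : al * \prod_(i < t) (1 - b i) * q (s1 ++ a' :: s2) * q s2 =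
  \prod_(i < t) (1 - b i) * (q (s1 ++ a' :: s2) * (al * q s2)) by ring.
apply: ler_wpM2l; first exact: prod_oneB_ge0.
by apply: ler_wpM2l; [exact/ltW/qp | exact: qal].
Qed.

(** Only the most recent disagreement contributes to the left-hand side; bounding it
by the sum over all of them makes the bound additive, so that it can be averaged. *)
Lemma kernel_continuity k (s x : k.-tuple A) a :
  `|q (a :: x) * q s - q (a :: s) * q x|
    <= (\sum_(j < k) b j * (tnth x j != tnth s j)%:R) * (q x * q s).
Proof.
have [qp qs _ qc hb] := q_reg.
have q_ge0 u : 0 <= q u by exact/ltW/qp.
have b_ge0 j : 0 <= b j by case/andP: (hb j).
have [->|nxs] := eqVneq x s.
  rewrite subrr normr0; apply: mulr_ge0; last exact: mulr_ge0.
  by apply: sumr_ge0 => j _; apply: mulr_ge0.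
have /existsP[j0 hj0] : [exists j, tnth x j != tnth s j].
  rewrite -negb_forall; apply: contra nxs => /forallP eqxs.
  by apply/eqP/eq_from_tnth => j; apply/eqP.
(* The least index is the most recent time. *)
case: (@arg_minnP _ j0 (fun j => tnth x j != tnth s j) val hj0) => j hj jmin.
have tk : take j x = take j s.
  have sz (u : k.-tuple A) : size (take j u) = j by rewrite size_takel // size_tuple ltnW.
  apply: (@eq_from_nth _ a); rewrite !sz // => i ij.
  rewrite !nth_take //.
  have ik : (i < k)%N by apply: ltn_trans ij _.
  have := jmin (Ordinal ik); case: eqVneq => [|_ /(_ isT)].
    by rewrite !(tnth_nth a).
  by rewrite /= leqNgt ij.
have ltj (u : k.-tuple A) : (j <= size u)%N by rewrite size_tuple ltnW.
have bnd := qc a j _ _ (ltj x) (ltj s) tk.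
apply: (@le_trans _ _ (b j * (q (a :: s) * q x))).
  by rewrite ler_norml; move/andP: bnd => [h1 h2]; apply/andP; split; lra.
have h : q (a :: s) * q x <= q x * q s.
  rewrite mulrC; apply: ler_wpM2l => //.
  by rewrite -[leRHS]qs (bigD1 a) //= lerDl; apply: sumr_ge0.
apply: le_trans (ler_wpM2l (b_ge0 j) h) _.
apply: ler_wpM2r; first exact: mulr_ge0.
rewrite (bigD1 j) //= hj mulr1 lerDl.
by apply: sumr_ge0 => i _; apply: mulr_ge0.
Qed.

End StringLaws.
(** * The mixture on a finite window *)

Section Mixture.
Context (R : realType) (A : finType) (eps : R) (q qY : seq A -> R).
Context (al : R) (b : nat -> R) (m : R) (k : nat) (s : k.-tuple A).
Context (eps_gt0 : 0 < eps) (eps_lt1 : eps < 1).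
Context (q_reg : regular_string_law q al b) (qY_gt0 : forall u, 0 < qY u).
Context (m_gt0 : 0 < m) (m_le1 : m <= 1).
Context (m_le : forall j, m <= al * \prod_(i < j) (1 - b i)).

Local Notation n := k.+1.
Local Notation V := (n.-tuple bool * (n.-tuple A * n.-tuple A))%type.
Implicit Types (v : V) (f g : V -> R) (Q : pred V).

(** A point [(e, (x, y))] lists the values of the noise and of the two processes at
the times [0, -1, ..., -k], and [weight] is its probability. Index [0] is the present
and [lift ord0 i] is the index of the entry [i] of a past. *)
Definition weight v : R := coins eps v.1 * (q v.2.1 * qY v.2.2).

Definition esp f : R := \sum_v weight v * f v.

Definition mass Q : R := esp (fun v => (Q v)%:R).

Definition zval v i : A := if tnth v.1 i then tnth v.2.1 i else tnth v.2.2 i.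

Definition zpast v : bool := [forall i, zval v (lift ord0 i) == tnth s i].

Definition zexc (j : 'I_k) v : bool :=
  [forall i, (i == j) || (zval v (lift ord0 i) == tnth s i)].

Lemma weight_gt0 v : 0 < weight v.
Proof.
have [qp _ _ _ _] := q_reg.
apply: mulr_gt0; last by apply: mulr_gt0.
apply: prodr_gt0 => i _; rewrite /coin; case: ifP => _ //.
by rewrite subr_gt0.
Qed.

Lemma ler_esp f g : (forall v, f v <= g v) -> esp f <= esp g.
Proof.
by move=> fg; apply: ler_sum => v _; apply: ler_wpM2l => //; exact/ltW/weight_gt0.
Qed.

Lemma ler_mass Q Q' : (forall v, Q v -> Q' v) -> mass Q <= mass Q'.
Proof.
by move=> h; apply: ler_esp => v; have := h v; case: (Q v) => // ->.
Qed.

Lemma mass_ge0 Q : 0 <= mass Q.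
Proof. by apply: sumr_ge0 => v _; apply: mulr_ge0 => //; exact/ltW/weight_gt0. Qed.

Lemma esp_resample t f :
  esp f = (1 - eps) * esp (fun v => f (upd v.1 t true, v.2))
          + eps * esp (fun v => f (upd v.1 t false, v.2)).
Proof.
have E h : esp h =
    \sum_(p : n.-tuple A * n.-tuple A) (q p.1 * qY p.2) * \sum_e coins eps e * h (e, p).
  have -> : esp h = \sum_e \sum_p weight (e, p) * h (e, p).
    by rewrite pair_bigA; apply: eq_bigr => -[].
  rewrite exchange_big /=.
  apply: eq_bigr => p _; rewrite mulr_sumr; apply: eq_bigr => e _.
  by rewrite /weight /=; ring.
rewrite !E !mulr_sumr -big_split /=; apply: eq_bigr => p _.
by rewrite (sum_coins_resample eps t) /=; ring.
Qed.

(** The sum over [x] is innermost: estimates for X alone can be applied with the noise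
and Y frozen. *)
Lemma esp_cond_X f :
  esp f = \sum_(e : n.-tuple bool) \sum_(y : n.-tuple A) (coins eps e * qY y) *
    \sum_(x : n.-tuple A) q x * f (e, (x, y)).
Proof.
have -> : esp f = \sum_e \sum_p weight (e, p) * f (e, p).
  by rewrite pair_bigA; apply: eq_bigr => -[].
apply: eq_bigr => e _.
have -> : \sum_p weight (e, p) * f (e, p) =
          \sum_x \sum_y weight (e, (x, y)) * f (e, (x, y)).
  by rewrite pair_bigA; apply: eq_bigr => -[].
rewrite exchange_big; apply: eq_bigr => y _; rewrite mulr_sumr.
by apply: eq_bigr => x _; rewrite /weight /=; ring.
Qed.

Lemma ler_esp_cond_X f g :
  (forall e y, \sum_(x : n.-tuple A) q x * f (e, (x, y))
     <= \sum_(x : n.-tuple A) q x * g (e, (x, y))) ->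
  esp f <= esp g.
Proof.
move=> fg; rewrite !esp_cond_X; apply: ler_sum => e _; apply: ler_sum => y _.
apply: ler_wpM2l => //; apply: mulr_ge0; last exact/ltW.
by apply: prodr_ge0 => i _; rewrite /coin; case: ifP => _; rewrite ?subr_ge0 ltW.
Qed.

Lemma zval_upd v t i (c : bool) : i != t ->
  zval (upd v.1 t c, v.2) i = zval v i.
Proof. by move=> it; rewrite /zval /= tnth_upd (negPf it). Qed.

Lemma lift0_neq (i j : 'I_k) : i != j -> lift (@ord0 k) i != lift ord0 j.
Proof. by apply: contra => /eqP /lift_inj ->. Qed.

Lemma zpastE j v :
  zpast v = (zval v (lift ord0 j) == tnth s j) && zexc j v.
Proof.
apply/forallP/andP => [h|[hj /forallP h] i].
  by split=> //; apply/forallP => i; rewrite h orbT.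
by case: (eqVneq i j) (h i) => [->|].
Qed.

Lemma zexc_upd j v (c : bool) : zexc j (upd v.1 (lift ord0 j) c, v.2) = zexc j v.
Proof.
apply: eq_forallb => i; case: eqVneq => //= ij.
by rewrite zval_upd // lift0_neq.
Qed.

Lemma zval_upd_same v t (c : bool) :
  zval (upd v.1 t c, v.2) t = if c then tnth v.2.1 t else tnth v.2.2 t.
Proof. by rewrite /zval /= tnth_upd eqxx. Qed.

Lemma zpast_upd0 v (c : bool) : zpast (upd v.1 ord0 c, v.2) = zpast v.
Proof. by apply: eq_forallb => i; rewrite zval_upd. Qed.

Lemma mass_zpast_gt0 : 0 < mass zpast.
Proof.
have [qp qs _ _ _] := q_reg.
have [a _] : exists a : A, true.
  case: (pickP [pred a : A | true]) => [a _|no]; first by exists a.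
  have := qp [::]; rewrite -(qs [::]) big1 ?ltxx // => a _.
  by have := no a.
pose x : n.-tuple A := [tuple of a :: s].
pose v : V := ([tuple true | i < n], (x, x)).
have pv : zpast v.
  by apply/forallP => i; rewrite /zval /= tnth_mktuple tnthS.
rewrite /mass /esp (bigD1 v) //= pv mulr1 ltr_pwDl ?weight_gt0 //.
by apply: sumr_ge0 => u _; apply: mulr_ge0 => //; exact/ltW/weight_gt0.
Qed.

(** With the noise and Y frozen, a function that ignores the entry [t] of X only sees
the sum of [q] along that coordinate, to which [single_site] applies. *)
Lemma esp_single_site t c g :
  (forall v, 0 <= g v) ->
  (forall e x y a, g (e, (upd x t a, y)) = g (e, (x, y))) ->
  m * esp g <= esp (fun v => (tnth v.2.1 t == c)%:R * g v).
Proof.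
have [qp _ _ _ _] := q_reg.
move=> g_ge0 g_upd; rewrite /esp mulr_sumr.
rewrite (eq_bigr (fun v => weight v * (m * g v))); last by move=> v _; ring.
apply: ler_esp_cond_X => e y.
rewrite [leLHS](sum_upd t c) [leRHS](bigID (fun x => tnth x t == c)) /=.
rewrite [X in _ <= _ + X]big1 ?addr0; last by move=> x /negPf ->; rewrite mul0r mulr0.
apply: ler_sum => x /eqP xt; rewrite xt eqxx mul1r.
have site : m * (\sum_a q (upd x t a)) <= q x.
  have {2}<- : upd x t c = x.
    by apply: eq_from_tnth => i; rewrite tnth_upd; case: eqP => [->|].
  apply: le_trans (single_site q_reg x t c).
  apply: ler_wpM2r => //.
  by apply: sumr_ge0 => a _; exact/ltW/qp.
under eq_bigr do rewrite g_upd.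
rewrite -mulr_suml mulrCA mulrA; apply: ler_wpM2r => //; exact: site.
Qed.

(** A disagreement of X with [s] where Z agrees with [s] forces the noise to select
Y there, which costs the factor [eps]. *)
Lemma mass_mismatch j :
  m * mass (fun v => (tnth v.2.1 (lift ord0 j) != tnth s j) && zpast v)
  <= eps * mass zpast.
Proof.
set t := lift ord0 j; set c := tnth s j.
pose MX := mass (fun v => (tnth v.2.1 t == c) && zexc j v).
pose MY := mass (fun v => (tnth v.2.2 t == c) && zexc j v).
pose MXY := mass (fun v => [&& tnth v.2.1 t != c, tnth v.2.2 t == c & zexc j v]).
(* [MXY] bounds [MX] and [MY] from below up to [m], hence so does their mixture. *)
have -> : mass zpast = (1 - eps) * MX + eps * MY.
  rewrite /mass (esp_resample t).
  by congr (_ * _ + _ * _); apply: eq_bigr => v _; congr (_ * _%:R);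
     rewrite (zpastE j) zval_upd_same zexc_upd.
have -> : mass (fun v => (tnth v.2.1 t != c) && zpast v) = eps * MXY.
  rewrite /mass (esp_resample t) [X in _ * X + _]big1 ?mulr0 ?add0r.
    congr (_ * _); apply: eq_bigr => v _; congr (_ * _%:R).
    by rewrite (zpastE j) zval_upd_same zexc_upd.
  move=> v _; rewrite (zpastE j) zval_upd_same /= zexc_upd.
  by case: (_ == _); rewrite /= mulr0.
rewrite mulrCA; apply: ler_wpM2l; first exact/ltW.
have hY : m * MXY <= MY.
  apply: (@le_trans _ _ MXY); first by apply: ler_piMl => //; exact: mass_ge0.
  by apply: ler_mass => v /and3P[_ -> ->].
have hX : m * MXY <= MX.
  apply: (@le_trans _ _ (m * mass (zexc j))).
    by apply: ler_wpM2l; [exact: ltW | apply: ler_mass => v /and3P[]].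
  apply: le_trans (esp_single_site (t := t) c _ _) _ => [v|e x y a|] //.
    congr ((nat_of_bool _)%:R); apply: eq_forallb => i; case: eqVneq => //= ij.
    by rewrite /zval /= tnth_upd (negPf (lift0_neq ij)).
  by apply: ler_sum => v _; case: (_ == _); rewrite /= ?mul1r ?mul0r.
have h1 : eps * (m * MXY) <= eps * MY by apply: ler_wpM2l => //; exact: ltW.
have h2 : (1 - eps) * (m * MXY) <= (1 - eps) * MX.
  by apply: ler_wpM2l => //; rewrite subr_ge0 ltW.
lra.
Qed.

Lemma ler_norm_esp_cond_X f g :
  (forall e y, `|\sum_(x : n.-tuple A) q x * f (e, (x, y))|
     <= \sum_(x : n.-tuple A) q x * g (e, (x, y))) ->
  `|esp f| <= esp g.
Proof.
move=> fg; rewrite ler_norml lerNl -sumrN; apply/andP; split.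
  rewrite (eq_bigr (fun v => weight v * (- f v))); last by move=> v _; rewrite mulrN.
  apply: ler_esp_cond_X => e y; apply: le_trans (fg e y).
  by rewrite -normrN -sumrN; under eq_bigr do rewrite mulrN; exact: ler_norm.
by apply: ler_esp_cond_X => e y; apply: le_trans (fg e y); exact: ler_norm.
Qed.

(** Given the past [x'] of X, its present symbol is independent of the noise and of Y,
hence of the past of Z. Summing out that symbol first leaves the difference of the
kernels at [x'] and at [s]. *)
Lemma kernel_deviation a :
  `|mass (fun v => (tnth v.2.1 ord0 == a) && zpast v) * q s - q (a :: s) * mass zpast|
  <= (\sum_(j < k) b j *
        mass (fun v => (tnth v.2.1 (lift ord0 j) != tnth s j) && zpast v)) * q s.
Proof.
have [qp qs _ _ hb] := q_reg.
pose B v := \sum_(j < k) b j * (tnth v.2.1 (lift ord0 j) != tnth s j)%:R.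
have -> : (\sum_(j < k) b j *
        mass (fun v => (tnth v.2.1 (lift ord0 j) != tnth s j) && zpast v)) * q s
   = esp (fun v => B v * q s * (zpast v)%:R).
  rewrite /esp mulr_suml.
  under [RHS]eq_bigr do rewrite /B !mulr_suml mulr_sumr.
  rewrite exchange_big; apply: eq_bigr => j _.
  rewrite /mass /esp mulr_sumr mulr_suml; apply: eq_bigr => v _.
  by rewrite -mulnb natrM; ring.
have -> : mass (fun v => (tnth v.2.1 ord0 == a) && zpast v) * q s
          - q (a :: s) * mass zpast
   = esp (fun v => ((tnth v.2.1 ord0 == a)%:R * q s - q (a :: s)) * (zpast v)%:R).
  rewrite /mass /esp mulr_suml mulr_sumr -sumrB; apply: eq_bigr => v _.
  by rewrite -mulnb natrM; ring.
apply: ler_norm_esp_cond_X => e y.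
rewrite [X in `|X|](sum_upd ord0 a) [leRHS](sum_upd ord0 a).
apply: le_trans (ler_norm_sum _ _ _) _; apply: ler_sum => x _.
set x' := behead_tuple x.
have hz c : zpast (e, (upd x ord0 c, y)) = zpast (e, (x, y)).
  by apply: eq_forallb => i; rewrite /zval /= !tnth_upd.
have hq c : q (upd x ord0 c) = q (c :: x') by rewrite val_upd take0 drop1.
have hB c : B (e, (upd x ord0 c, y)) = \sum_(j < k) b j * (tnth x' j != tnth s j)%:R.
  apply: eq_bigr => j _; rewrite tnth_upd /= tnth_behead.
  by congr (_ * (_ != _)%:R); congr tnth; apply: val_inj; rewrite /= inordK // ltnS.
have -> : \sum_c q (upd x ord0 c) * (B (e, (upd x ord0 c, y)) * q s *
     (zpast (e, (upd x ord0 c, y)))%:R) =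
   ((\sum_(j < k) b j * (tnth x' j != tnth s j)%:R) * (q x' * q s)) *
     (zpast (e, (x, y)))%:R.
  under eq_bigr do rewrite hB hz hq.
  by rewrite -mulr_suml qs; ring.
have -> : \sum_c q (upd x ord0 c) *
     (((tnth (upd x ord0 c) ord0 == a)%:R * q s - q (a :: s)) *
     (zpast (e, (upd x ord0 c, y)))%:R) =
   (q (a :: x') * q s - q (a :: s) * q x') * (zpast (e, (x, y)))%:R.
  under eq_bigr do rewrite tnth_upd eqxx hz hq mulrA mulrBr mulrCA mulrA.
  rewrite -mulr_suml sumrB; congr (_ * _); congr (_ - _).
    by rewrite (bigD1 a) //= eqxx mul1r big1 ?addr0 // => c /negPf ->; rewrite !mul0r.
  by rewrite -mulr_suml qs mulrC.
rewrite normrM [X in _ * X]ger0_norm //; apply: ler_wpM2r => //.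
exact: (kernel_continuity q_reg s x' a).
Qed.

(** For an alphabet with one letter the left-hand side vanishes, and for a larger one
the factor is at least [1]. *)
Lemma mass_mismatch_card j :
  m * mass (fun v => (tnth v.2.1 (lift ord0 j) != tnth s j) && zpast v)
  <= (#|A|%:R - 1) * (eps * mass zpast).
Proof.
have A_gt0 : (0 < #|A|)%N by apply/card_gt0P; exists (tnth s j).
have epsD : 0 <= eps * mass zpast by rewrite mulr_ge0 ?mass_ge0 // ltW.
have [A_gt1|A_le1] := ltnP 1 #|A|.
  apply: le_trans (mass_mismatch j) _; rewrite ler_peMl // lerBrDr.
  by rewrite -[1 + 1]/(2%:R) ler_nat.
rewrite [X in m * X]big1; first by rewrite mulr0 mulr_ge0 // subr_ge0 ler1n.
move=> v _; have -> : tnth v.2.1 (lift ord0 j) = tnth s j.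
  exact: (fintype_le1P A_le1).
by rewrite eqxx mulr0.
Qed.

(** The term [1] is the cost of replacing Y by X at the present time, the other one is
the effect of the noise in the past. *)
Lemma mixture_kernel_bound a :
  `|mass (fun v => (zval v ord0 == a) && zpast v) / mass zpast - q (a :: s) / q s|
  <= eps * (1 + (#|A|%:R - 1) * (\sum_(j < k) b j) / m).
Proof.
have [qp _ _ _ hb] := q_reg.
have D_gt0 := mass_zpast_gt0.
set D := mass zpast in D_gt0 *.
pose MX := mass (fun v => (tnth v.2.1 ord0 == a) && zpast v).
pose MY := mass (fun v => (tnth v.2.2 ord0 == a) && zpast v).
have -> : mass (fun v => (zval v ord0 == a) && zpast v) = (1 - eps) * MX + eps * MY.
  rewrite /mass (esp_resample ord0).
  by congr (_ * _ + _ * _); apply: eq_bigr => v _; rewrite zval_upd_same zpast_upd0.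
have MX_ge0 : 0 <= MX by exact: mass_ge0.
have MY_ge0 : 0 <= MY by exact: mass_ge0.
have MX_le : MX <= D by apply: ler_mass => v /andP[].
have MY_le : MY <= D by apply: ler_mass => v /andP[].
set S := \sum_(j < k) b j.
have devX : `|MX / D - q (a :: s) / q s| <= eps * ((#|A|%:R - 1) * S / m).
  have -> : MX / D - q (a :: s) / q s = (MX * q s - q (a :: s) * D) / (D * q s).
    by field; rewrite ?gt_eqF ?qp.
  have Dq : 0 < D * q s by exact: mulr_gt0.
  rewrite normrM normfV (gtr0_norm Dq) ler_pdivrMr //.
  apply: le_trans (kernel_deviation a) _.
  rewrite mulrA; apply: ler_wpM2r; first exact/ltW.
  have -> : eps * ((#|A|%:R - 1) * S / m) * D =
      \sum_(j < k) b j * ((#|A|%:R - 1) * (eps * D) / m).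
    by rewrite -mulr_suml -/S; ring.
  apply: ler_sum => j _; apply: ler_wpM2l; first by case/andP: (hb j).
  by rewrite ler_pdivlMr // mulrC; exact: mass_mismatch_card.
have devY : `|eps * (MY / D - MX / D)| <= eps.
  rewrite normrM gtr0_norm //; apply: ler_piMr; first exact/ltW.
  rewrite -mulrBl normrM normfV.
  rewrite (gtr0_norm D_gt0) ler_pdivrMr // mul1r ler_norml; apply/andP; split; lra.
have -> : ((1 - eps) * MX + eps * MY) / D - q (a :: s) / q s =
   (MX / D - q (a :: s) / q s) + eps * (MY / D - MX / D) by ring.
apply: le_trans (ler_normD _ _) _.
by rewrite [leRHS]mulrDr mulr1 addrC lerD.
Qed.

End Mixture.
(** * Cylinders in path space *)

Section ProductSigmaAlgebra.
Context (I A : Type).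

Lemma prod_salgebraI (B B' : set (I -> A)) :
  prod_salgebra B -> prod_salgebra B' -> prod_salgebra (B `&` B').
Proof.
have [ps0 psD psU] := smallest_sigma_algebra setT (@cylinders I A).
have psC (C : set (I -> A)) : prod_salgebra C -> prod_salgebra (~` C).
  by move=> hC; have := psD C hC; rewrite setTD.
move=> hB hB'; rewrite -[B `&` B']setCK setCI; apply: (psC (~` B `|` ~` B')).
rewrite -bigcup2E; apply: (psU (bigcup2 (~` B) (~` B'))) => -[|[|i]] /=.
- exact: psC.
- exact: psC.
- exact: ps0.
Qed.

(** The map [f] selects the coordinates: a decreasing one for trajectories, the identity
for pasts. *)
Lemma prod_salgebra_string (s : seq A) (f : nat -> I) :
  prod_salgebra [set z : I -> A | mkseq (z \o f) (size s) = s].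
Proof.
elim: s f => [|a s IH] f.
  have -> : [set z : I -> A | mkseq (z \o f) (size (@nil A)) = [::]] = setT `\` set0.
    by rewrite setD0; apply/seteqP; split.
  have [ps0 psC _] := smallest_sigma_algebra setT (@cylinders I A).
  exact: psC.
have -> : [set z : I -> A | mkseq (z \o f) (size (a :: s)) = a :: s] =
    [set z : I -> A | z (f 0%N) = a] `&`
      [set z : I -> A | mkseq (z \o (f \o succn)) (size s) = s].
  apply/seteqP; split=> z /=; rewrite /mkseq /= -[1%N]addn0 iotaDl -map_comp.
    by case=> -> hs; split => //.
  by case=> -> hs; congr cons.
apply: prod_salgebraI; last exact: IH.
by apply: sub_gen_smallest; exists (f 0%N), a.
Qed.

Lemma measurable_prod_salgebra_preimage d (T : measurableType d) (F : T -> I -> A) :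
  (forall t a, measurable [set w | F w t = a]) ->
  forall B, prod_salgebra B -> measurable (F @^-1` B).
Proof.
move=> mF; apply: smallest_sub => [|_ [t [a ->]]]; last exact: mF.
split.
- by rewrite preimage_set0.
- by move=> B mB; rewrite setTD preimage_setC; exact: measurableC.
- move=> B mB; rewrite preimage_bigcup; exact: bigcupT_measurable.
Qed.

End ProductSigmaAlgebra.

(** * Observables with finitely many values *)

Section FiniteObservable.
Context (d : measure_display) (T : measurableType d) (R : realType).
Context (P : probability T R).

Lemma probability_observable (V : finType) (O : T -> V) (Q : pred V) :
  (forall v, measurable [set w | O w = v]) ->
  fine (P [set w | Q (O w)]) = \sum_(v | Q v) fine (P [set w | O w = v]).
Proof.
move=> mO.
have key (r : seq V) : uniq r ->
    measurable [set w | O w \in r] /\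
    P [set w | O w \in r] = (\sum_(v <- r) P [set w | O w = v])%E.
  elim: r => [_|v r IH /= /andP[vr /IH[mr Pr]]].
    have -> : [set w | O w \in [::]] = set0 by apply/seteqP; split.
    by rewrite big_nil measure0; split.
  have -> : [set w | O w \in v :: r] = [set w | O w = v] `|` [set w | O w \in r].
    apply/seteqP; split=> w /=; rewrite inE.
      by case/orP => [/eqP|]; [left | right].
    by case=> [->|->]; rewrite ?eqxx ?orbT.
  split; first exact: measurableU.
  rewrite big_cons -Pr measureU //.
  by apply/seteqP; split=> w //= [-> ]; apply/negP.
have [_ PQ] := key (enum Q) (enum_uniq _).
have -> : [set w | Q (O w)] = [set w | O w \in enum Q].
  by apply/seteqP; split=> w /=; rewrite mem_enum.
rewrite PQ -sum_fine; last by move=> v _; exact: fin_num_measure.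
by rewrite big_enum.
Qed.

End FiniteObservable.

(** * The string law of a stationary process *)

Section StringLawOfProcess.
Context (d : measure_display) (T : measurableType d) (R : realType).
Context (P : probability T R).

Definition window (A : Type) (W : int -> T -> A) (n : nat) (w : T) : seq A :=
  mkseq (fun i => W (- i%:Z) w) n.

Definition string_law (A : Type) (W : int -> T -> A) (s : seq A) : R :=
  fine (P [set w | window W (size s) w = s]).

Section OneProcess.
Context (A : finType) (W : int -> T -> A).
Context (W_process : is_process W) (W_stat : stationary P W).

Let cyl (s : seq A) : set (nat -> A) := [set x | mkseq x (size s) = s].

Lemma measurable_window s : measurable [set w | window W (size s) w = s].
Proof.
have := measurable_prod_salgebra_preimage W_process
  (prod_salgebra_string s (fun i => - i%:Z)).
by [].
Qed.

Lemma measurable_past (B : set (nat -> A)) : prod_salgebra B -> measurable (past W @^-1` B).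
Proof.
by apply: measurable_prod_salgebra_preimage => t a; exact: W_process.
Qed.

Lemma prod_salgebra_cyl s : prod_salgebra (cyl s).
Proof. exact: (prod_salgebra_string s id). Qed.

(** Stationarity identifies the law of the window that ends at time [0] with that of the
window that ends at time [-1]. *)
Lemma string_law_past s : P (past W @^-1` cyl s) = (string_law W s)%:E.
Proof.
rewrite fineK; last exact/fin_num_measure/measurable_window.
have := W_stat (prod_salgebra_string s (fun i => - (i.+1)%:Z)).
move=> <-; congr (P _); apply/seteqP; split=> w /=;
  rewrite /window /time_shift /trajectory => {2}<-; apply: eq_map => i /=;
  by rewrite -addn1 PoszD opprD addrNK.
Qed.

Lemma string_law_cons a s :
  P (W 0 @^-1` [set a] `&` past W @^-1` cyl s) = (string_law W (a :: s))%:E.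
Proof.
rewrite fineK; last exact/fin_num_measure/measurable_window.
congr (P _); apply/seteqP; split=> w /=;
  rewrite /window /mkseq /= -[1%N]addn0 iotaDl -map_comp oppr0.
  by move=> [-> hs]; congr cons.
by case=> -> hs.
Qed.

Lemma string_law_nil : string_law W [::] = 1.
Proof.
rewrite /string_law.
have -> : [set w | window W (size (@nil A)) w = [::]] = setT by apply/seteqP; split.
by rewrite probability_setT.
Qed.

(** The pair of the present symbol and of the indicator of the past event takes
finitely many values. *)
Lemma string_law_sum s : \sum_a string_law W (a :: s) = string_law W s.
Proof.
have mc := measurable_past (prod_salgebra_cyl s).
pose O w : A * bool := (W 0 w, `[< cyl s (past W w) >]).
have OE a (c : bool) : [set w | O w = (a, c)] =
   W 0 @^-1` [set a] `&` (if c then past W @^-1` cyl s else ~` (past W @^-1` cyl s)).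
  apply/seteqP; split=> w; rewrite /O /=.
    by case=> ->; case: asboolP => h <-; split.
  by case: c => -[-> h]; congr pair; [apply/asboolT|apply/asboolF].
have mO v : measurable [set w | O w = v].
  case: v => a c; rewrite OE; apply: measurableI; first exact: W_process.
  by case: c => //; exact: measurableC.
have -> : string_law W s = fine (P [set w | (O w).2]).
  rewrite -[string_law W s]/(fine (string_law W s)%:E) -string_law_past.
  by congr (fine (P _)); apply/seteqP; split=> w /= /asboolP.
rewrite (probability_observable P snd mO).
rewrite (reindex_onto (fun a => (a, true)) fst) /=; last by case=> a [].
under [RHS]eq_bigl do rewrite eqxx.
by apply: eq_bigr => a _; rewrite OE string_law_cons.
Qed.

Context (p : A -> (nat -> A) -> R) (W_cond : is_past_cond_prob P W p).

Let measurable_kernel a :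
  measurable_fun setT (fun w => (p a (past W w))%:E).
Proof.
have [_ _ mp _] := W_cond.
apply/measurable_EFinP => _ V mV; rewrite setTI.
exact: (measurable_past (mp a V mV)).
Qed.

Lemma string_law_cons_ge a s c : 0 <= c ->
  (forall x, mkseq x (size s) = s -> c <= p a x) ->
  c * string_law W s <= string_law W (a :: s).
Proof.
have [p_ge0 _ _ Wc] := W_cond.
move=> c_ge0 hc; rewrite -lee_fin -string_law_cons EFinM -string_law_past.
have mc := measurable_past (prod_salgebra_cyl s).
rewrite (Wc a _ (prod_salgebra_cyl s)) -(integral_cst P mc).
apply: ge0_le_integral => //.
- by apply: measurable_funS (measurable_kernel a).
- by move=> w /hc; rewrite lee_fin.
Qed.

Lemma string_law_cons_le a s c :
  (forall x, mkseq x (size s) = s -> p a x <= c) ->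
  string_law W (a :: s) <= c * string_law W s.
Proof.
have [p_ge0 _ _ Wc] := W_cond.
move=> hc; rewrite -lee_fin -string_law_cons EFinM -string_law_past.
have mc := measurable_past (prod_salgebra_cyl s).
rewrite (Wc a _ (prod_salgebra_cyl s)) -(integral_cst P mc).
apply: ge0_le_integral => //.
- by move=> w _; rewrite lee_fin.
- by apply: measurable_funS (measurable_kernel a).
- by move=> w /hc; rewrite lee_fin.
Qed.

Context (p_nonnull : nonnull p).

Lemma alpha_le a x : alpha p <= p a x.
Proof.
have [p_ge0 _ _ _] := W_cond.
apply: ge_inf; last by exists a, x.
by exists 0 => _ [a' [x' ->]].
Qed.

Lemma string_law_gt0 s : 0 < string_law W s.
Proof.
elim: s => [|a s IH]; first by rewrite string_law_nil.
apply: lt_le_trans (string_law_cons_ge (ltW p_nonnull) (fun x _ => alpha_le a x)).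
exact: mulr_gt0.
Qed.

Let p_gt0 a x : 0 < p a x.
Proof. exact: lt_le_trans (alpha_le a x). Qed.

Lemma kernel_le1 a x : p a x <= 1.
Proof.
have [p_ge0 p_sum _ _] := W_cond.
by rewrite -(p_sum x) (bigD1 a) //= lerDl; apply: sumr_ge0.
Qed.

(** The supremum that defines [beta] is over a set bounded by [1 + 1 / alpha], hence it
is a genuine upper bound. *)
Lemma beta_ratio j a x y : (forall i, (i < j)%N -> x i = y i) ->
  `|1 - p a x / p a y| <= beta p j.
Proof.
move=> xy; apply: ub_le_sup; last by exists a, x, y.
exists (1 + (alpha p)^-1) => _ [a' [x' [y' [_ ->]]]].
apply: le_trans (ler_normB _ _) _; rewrite normr1 lerD2l.
rewrite ger0_norm; last by apply: divr_ge0; exact/ltW.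
rewrite -[leRHS]mul1r; apply: ler_pM.
- exact/ltW.
- by rewrite invr_ge0; exact/ltW.
- exact: kernel_le1.
- by rewrite lef_pV2 ?posrE // alpha_le.
Qed.

Lemma beta_ge0 j : 0 <= beta p j.
Proof.
have [p_ge0 p_sum _ _] := W_cond.
have [w _] : exists w : T, True.
  apply: contrapT => no; have := probability_setT P.
  have -> : [set: T] = set0 by apply/seteqP; split=> // w _; case: no; exists w.
  by rewrite measure0 => /eqP; rewrite eqe eq_sym oner_eq0.
by apply: le_trans (beta_ratio (W 0 w) (x := past W w) (y := past W w) _).
Qed.

Lemma kernel_ratio_bounds j a x y : (forall i, (i < j)%N -> x i = y i) ->
  (1 - beta p j) * p a y <= p a x <= (1 + beta p j) * p a y.
Proof.
move=> xy; have := beta_ratio a xy; rewrite ler_norml => /andP[h1 h2].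
by apply/andP; split; [rewrite -ler_pdivlMr //|rewrite -ler_pdivrMr //]; lra.
Qed.

(** The conditional probability given a finite past is an average of the kernel over the
cylinder of that past. A comparison of the kernel at any two points of two cylinders
is therefore inherited by the averages, through one integration over each cylinder. *)
Lemma regular_string_law_of_process : (forall j, beta p j < 1) ->
  regular_string_law (string_law W) (alpha p) (beta p).
Proof.
move=> beta_lt1; have [p_ge0 p_sum _ _] := W_cond.
split.
- exact: string_law_gt0.
- exact: string_law_sum.
- by move=> a s; apply: string_law_cons_ge (ltW p_nonnull) _ => x _; exact: alpha_le.
- move=> a j s s' js js' tk.
  have agree x y : mkseq x (size s) = s -> mkseq y (size s') = s' ->
      forall i, (i < j)%N -> x i = y i.
    move=> xs ys i ij.
    have nthE u z : mkseq z (size u) = u -> (j <= size u)%N -> nth (x i) (take j u) i = z i.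
      move=> zu ju; rewrite nth_take // -{1}zu nth_mkseq //; exact: leq_trans ju.
    by rewrite -(nthE s x xs js) tk (nthE s' y ys js').
  have q_gt0 := string_law_gt0.
  have b1 : 0 < 1 - beta p j by rewrite subr_gt0.
  have b2 : 0 < 1 + beta p j by rewrite ltr_pwDl // beta_ge0.
  (* In both bounds the outer integration is over the cylinder of [s] and the inner
     one, with [x] fixed, over that of [s']. *)
  apply/andP; split.
    rewrite mulrA -ler_pdivrMr //.
    have -> : (1 - beta p j) * string_law W (a :: s') * string_law W s / string_law W s'
      = (1 - beta p j) * string_law W (a :: s') / string_law W s' * string_law W s.
      by ring.
    apply: string_law_cons_ge => [|x xs].
      by rewrite !mulr_ge0 ?invr_ge0 // ltW.
    rewrite ler_pdivrMr // mulrC -ler_pdivlMr // mulrAC.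
    apply: string_law_cons_le => y ys; rewrite ler_pdivlMr // mulrC.
    by have /andP[] := kernel_ratio_bounds a (agree x y xs ys).
  rewrite mulrA -ler_pdivlMr //.
  have -> : (1 + beta p j) * string_law W (a :: s') * string_law W s / string_law W s'
      = (1 + beta p j) * string_law W (a :: s') / string_law W s' * string_law W s.
    by ring.
  apply: string_law_cons_le => x xs.
  rewrite ler_pdivlMr // [leRHS]mulrC -ler_pdivrMr // mulrAC.
  apply: string_law_cons_ge => [|y ys]; first by rewrite divr_ge0 // ltW.
  rewrite ler_pdivrMr // mulrC.
  by have /andP[] := kernel_ratio_bounds a (agree x y xs ys).
- by move=> j; rewrite beta_ge0 ltW.
Qed.

End OneProcess.
End StringLawOfProcess.
(** * The joint law of the noise and the two processes *)

Section JointLaw.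
Context (d : measure_display) (T : measurableType d) (R : realType).
Context (P : probability T R) (A : finType) (eps : R).
Context (X Y : int -> T -> A) (xi : int -> T -> bool).
Context (X_process : is_process X) (Y_process : is_process Y).
Context (xi_process : is_process xi).
Context (XY_indep : independent_processes P X Y).
Context (xi_indep : independent_processes P xi (pair_process X Y)).
Context (xi_iid : bernoulli_iid P xi (1 - eps)).

Lemma string_law_coins n (e : n.-tuple bool) : string_law P xi e = coins eps e.
Proof.
have [xi_mut xi_true] := xi_iid.
have xi_coin t c : P (xi t @^-1` [set c]) = (coin eps c)%:E.
  case: c; first exact: xi_true.
  have -> : xi t @^-1` [set false] = ~` (xi t @^-1` [set true]).
    by apply/seteqP; split=> w /=; case: (xi t w).
  rewrite probability_setC; last exact: xi_process.
  by rewrite xi_true -EFinB; congr (_%:E); rewrite /=; ring.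
pose r := [seq - i%:Z | i <- iota 0 n].
have r_uniq : uniq r by rewrite map_inj_uniq ?iota_uniq // => i j /oppr_inj [].
(* The times are all nonpositive, so that the absolute value recovers the index. *)
have := xi_mut r (fun t => [set nth true e `|t|%N]) r_uniq.
have -> : \bigcap_(t in [set` r]) (xi t @^-1` [set nth true e `|t|%N]) =
          [set w | window xi (size e) w = e].
  rewrite size_tuple; apply/seteqP; split=> w /= hw.
    apply: (@eq_from_nth _ true); rewrite size_mkseq ?size_tuple // => i lt_in.
    rewrite nth_mkseq // (hw (- i%:Z)) ?abszN //.
    by apply: map_f; rewrite mem_iota.
  move=> t /= /mapP[i]; rewrite mem_iota => /= lt_in ->.
  by rewrite abszN /= -[in RHS]hw nth_mkseq.
rewrite /string_law => ->; rewrite big_map.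
rewrite (eq_bigr (fun i => (coin eps (nth true e i))%:E)); last first.
  by move=> i _; rewrite xi_coin abszN.
have -> : iota 0 n = index_iota 0 n by rewrite /index_iota subn0.
rewrite prodEFin /= big_mkord.
by apply: eq_bigr => i _; rewrite (tnth_nth true).
Qed.

Definition observe n (w : T) : n.-tuple bool * (n.-tuple A * n.-tuple A) :=
  ([tuple xi (- (i : nat)%:Z) w | i < n],
   ([tuple X (- (i : nat)%:Z) w | i < n], [tuple Y (- (i : nat)%:Z) w | i < n])).

Let tuple_window (B : Type) (W : int -> T -> B) n w :
  [tuple W (- (i : nat)%:Z) w | i < n] = window W n w :> seq B.
Proof. by rewrite /window /mkseq -val_enum_ord -map_comp. Qed.

Lemma observeE n e x y : [set w | observe n w = (e, (x, y))] =
  [set w | window xi (size e) w = e] `&`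
  ([set w | window X (size x) w = x] `&` [set w | window Y (size y) w = y]).
Proof.
rewrite !size_tuple; apply/seteqP; split=> w /=.
  by rewrite /observe => -[<- <- <-]; rewrite !tuple_window.
by move=> [he [hx hy]]; congr (_, (_, _)); apply: val_inj; rewrite /= tuple_window.
Qed.

Lemma measurable_observe n v : measurable [set w | observe n w = v].
Proof.
case: v => e [x y]; rewrite observeE.
by apply: measurableI; [|apply: measurableI]; exact: measurable_window.
Qed.

Lemma observe_law n v :
  fine (P [set w | observe n w = v]) =
  coins eps v.1 * (string_law P X v.2.1 * string_law P Y v.2.2).
Proof.
case: v => e [x y]; rewrite observeE /=.
have := xi_indep (prod_salgebra_string e (fun i => - i%:Z))
  (prod_salgebra_string (zip x y) (fun i => - i%:Z)).
have -> : trajectory (pair_process X Y) @^-1`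
    [set z : int -> A * A | mkseq (z \o (fun i => - i%:Z)) (size (zip x y)) = zip x y] =
    [set w | window X (size x) w = x] `&` [set w | window Y (size y) w = y].
  rewrite size_zip !size_tuple minnn; apply/seteqP; split=> w /=; rewrite /mkseq => h.
    have sz : size x = size y by rewrite !size_tuple.
    split.
      by rewrite -[RHS](@unzip1_zip _ _ x y) ?sz // -h /unzip1 -map_comp.
    by rewrite -[RHS](@unzip2_zip _ _ x y) ?sz // -h /unzip2 -map_comp.
  by case: h => <- <-; rewrite zip_map.
move=> ->.
have /= -> := XY_indep (prod_salgebra_string x (fun i => - i%:Z))
  (prod_salgebra_string y (fun i => - i%:Z)).
rewrite !fineM ?fin_numM ?fin_num_measure //; try exact: measurable_window.
by rewrite -string_law_coins.
Qed.

Lemma mass_observe k (Q : pred _) :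
  fine (P [set w | Q (observe k.+1 w)]) = mass eps (string_law P X) (string_law P Y) Q.
Proof.
rewrite (probability_observable P Q (@measurable_observe k.+1)) big_mkcond /=.
apply: eq_bigr => v _; rewrite observe_law /weight.
by case: (Q v); rewrite ?mulr1 ?mulr0.
Qed.

Lemma mixture_past_event k (s : k.-tuple A) :
  past_event (mixture xi X Y) s = [set w | zpast s (observe k.+1 w)].
Proof.
apply/seteqP; split=> w.
  move=> h; apply/forallP => i; apply/eqP.
  by rewrite -(h i) /zval /observe /= !tnth_mktuple.
move=> /forallP h i; have /eqP <- := h i.
by rewrite /zval /observe /= !tnth_mktuple.
Qed.

Lemma mixture_present_event k (s : k.-tuple A) a :
  mixture xi X Y 0 @^-1` [set a] `&` past_event (mixture xi X Y) s =
  [set w | (zval (observe k.+1 w) ord0 == a) && zpast s (observe k.+1 w)].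
Proof.
have e w : mixture xi X Y 0 w = zval (observe k.+1 w) ord0.
  by rewrite /zval /observe /= !tnth_mktuple oppr0.
rewrite mixture_past_event; apply/seteqP; split=> w /=; rewrite e.
  by case=> -> ->; rewrite eqxx.
by case/andP => /eqP -> ->.
Qed.

Lemma mixture_p_str k (s : k.-tuple A) a :
  let mu := mass eps (string_law P X) (string_law P Y) in
  p_str P (mixture xi X Y) a s =
  mu _ (fun v => (zval v ord0 == a) && zpast s v) / mu _ (zpast s).
Proof.
rewrite /p_str mixture_present_event mixture_past_event.
by rewrite (mass_observe (fun v => (zval v ord0 == a) && zpast s v)) mass_observe.
Qed.

End JointLaw.

Lemma p_str_string_law d (T : measurableType d) (R : realType)
    (P : probability T R) (A : finType) (W : int -> T -> A) k (s : k.-tuple A) a :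
  is_process W -> stationary P W ->
  p_str P W a s = string_law P W (a :: s) / string_law P W s.
Proof.
move=> W_process W_stat.
have pE : past_event W s = past W @^-1` [set x | mkseq x (size s) = s].
  rewrite size_tuple; apply/seteqP; split=> w /= h.
    apply: (@eq_from_nth _ a); rewrite size_mkseq ?size_tuple // => i ik.
    by rewrite nth_mkseq // /past (h (Ordinal ik)) (tnth_nth a).
  by move=> i; rewrite (tnth_nth a) -[in RHS]h nth_mkseq.
by rewrite /p_str pE string_law_cons // string_law_past.
Qed.

(** * Limits of the continuity rates *)

Section BetaLimits.
Context (R : realType) (A : Type) (p : A -> (nat -> A) -> R).
Context (beta_ge0 : forall j, 0 <= beta p j).

Lemma sum_beta_le k : summable_continuity p -> \sum_(j < k) beta p j <= beta_total p.
Proof.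
have -> : \sum_(j < k) beta p j = series (beta p) k by rewrite seriesEord.
move=> p_sum; apply: nondecreasing_cvgn_le => //.
apply: homo_leq => [//|y x z|n]; first exact: le_trans.
by rewrite seriesEnat /= big_nat_recr /= ?lerDl.
Qed.

Lemma beta_star_le k : (forall j, beta p j < 1) ->
  beta_star p <= \prod_(j < k) (1 - beta p j).
Proof.
move=> beta_lt1; set u := fun n => \prod_(j < n) (1 - beta p j).
have u_ge0 n : 0 <= u n by apply: prodr_ge0 => j _; rewrite subr_ge0 ltW.
have u_noninc : {homo u : n m / (n <= m)%N >-> m <= n}.
  apply: (homo_leq (r := fun x y : R => y <= x)) => [//|y x z|n].
    by move=> xy yz; exact: le_trans yz xy.
  by rewrite /u big_ord_recr; apply: ler_piMr; [exact: u_ge0 | rewrite gerBl].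
apply: (nonincreasing_cvgn_ge u_noninc).
apply: nonincreasing_is_cvgn => //.
by exists 0 => _ [n _ <-].
Qed.

End BetaLimits.

(** * The main estimate *)

Theorem theorem3p4 (d : measure_display) (T : measurableType d) (R : realType)
  (P : probability T R) (N : nat)
  (X Y : int -> T -> 'I_N) (xi : int -> T -> bool)
  (pX pY : 'I_N -> (nat -> 'I_N) -> R) (eps : R)
  (X_process : is_process X) (Y_process : is_process Y)
  (xi_process : is_process xi)
  (X_stationary : stationary P X) (Y_stationary : stationary P Y)
  (X_ergodic : ergodic P X) (Y_ergodic : ergodic P Y)
  (X_cond : is_past_cond_prob P X pX) (Y_cond : is_past_cond_prob P Y pY)
  (X_nonnull : nonnull pX) (Y_nonnull : nonnull pY)
  (X_summable : summable_continuity pX) (Y_summable : summable_continuity pY)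
  (* positivity of the infinite product, including that of its factors *)
  (X_beta_lt1 : forall k, beta pX k < 1) (X_beta_star : 0 < beta_star pX)
  (XY_indep : independent_processes P X Y)
  (xi_indep : independent_processes P xi (pair_process X Y))
  (xi_iid : bernoulli_iid P xi (1 - eps))
  (eps_gt0 : 0 < eps) (eps_lt1 : eps < 1) :
  (ereal_sup [set
     ereal_sup [set
       ereal_sup [set
         (`| p_str P (mixture xi X Y) a s - p_str P X a s |)%:E
       | s in [set: k.-tuple 'I_N]]
     | a in [set: 'I_N]]
   | k in [set k : nat | (1 <= k)%N]]
   <= (eps * (2 + 4 * (N%:R - 1) * beta_total pX /
         Num.min 1 (Num.min (alpha pX * beta_star pX) (alpha pY))))%:E)%E.
Proof.
have X_reg := regular_string_law_of_process X_process X_stationary X_cond X_nonnull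
  X_beta_lt1.
have bX_ge0 := beta_ge0 X_cond X_nonnull.
have Y_gt0 := string_law_gt0 Y_process Y_stationary Y_cond Y_nonnull.
set m := Num.min _ _.
have m_gt0 : 0 < m by rewrite !lt_min ltr01 mulr_gt0.
have m_le1 : m <= 1 by rewrite ge_min lexx.
have m_le j : m <= alpha pX * \prod_(i < j) (1 - beta pX i).
  apply: (@le_trans _ _ (alpha pX * beta_star pX)); first by rewrite !ge_min lexx orbT.
  by apply: ler_wpM2l; [exact: ltW | exact: beta_star_le].
have sum_le k : \sum_(j < k) beta pX j <= beta_total pX by exact: (sum_beta_le bX_ge0).
apply: ge_ereal_sup => _ [k _ <-]; apply: ge_ereal_sup => _ [a _ <-].
apply: ge_ereal_sup => _ [s _ <-]; rewrite lee_fin (p_str_string_law s a X_process) //.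
rewrite (mixture_p_str X_process Y_process xi_process XY_indep xi_indep xi_iid).
apply: le_trans (mixture_kernel_bound s eps_gt0 eps_lt1 X_reg Y_gt0 m_gt0 m_le1 m_le a) _.
rewrite card_ord; apply: ler_wpM2l; first exact: ltW.
have N1_ge0 : 0 <= N%:R - 1 :> R.
  by rewrite subr_ge0 ler1n; apply: leq_ltn_trans (ltn_ord a).
(* Here [1 + (N - 1) beta / m <= 2 + 4 (N - 1) beta / m], term by term. *)
apply: lerD; first by rewrite ler1n.
apply: ler_wpM2r; first by rewrite invr_ge0 ltW.
apply: ler_pM => //; first by apply: sumr_ge0.
by rewrite ler_peMl // ler1n.
Qed.
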